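(* Let $p>1$. Suppose that $\mathcal{G}$ is connected and $\lambda_1<\lambda_2\le\dots\le\lambda_N$ are the variational eigenvalues of a generalized $p$-Laplacian $\mathcal{H}_p$ on $\mathcal{G}$. Let $\lambda$ be an eigenvalue of $\mathcal{H}_p$ such that $\lambda<\lambda_k$. Then any eigenfunction associated to $\lambda$ induces at most $k-1$ nodal domains.
   Context: Let $\mathcal{G}=(V,E)$ be a finite undirected simple graph with $N=|V|$ nodes, positive node weights $\varrho:V\to\mathbb{R}_+$ and positive symmetric edge weights $\omega:E\to\mathbb{R}_+$; $v\sim u$ means that $uv\in E$. For $p>1$ put $\phi_p(x)=|x|^{p-2}x$ (with $\phi_p(0)=0$). Given real coefficients $\kappa_u$, $u\in V$, the generalized $p$-Laplacian is $(\mathcal{H}_p f)(u)=\sum_{v\sim u}\omega_{uv}\phi_p(f(u)-f(v))+\kappa_u\phi_p(f(u))$ for $f:V\to\mathbb{R}$. A nonzero $f$ is an eigenfunction with eigenvalue $\lambda\in\mathbb{R}$ if $(\mathcal{H}_pf)(u)=\lambda\varrho_u\phi_p(f(u))$ for all $u\in V$. Krasnoselskii genus: for a closed symmetric set $A=-A$ in $\mathbb{R}^N$, $\gamma(A)$ is the least $k\in\mathbb{N}$ such that there is a continuous odd map $\varphi:A\to\mathbb{R}^k$ with $0\notin\varphi(A)$; $\gamma(A)=\infty$ if no such $k$ exists and $\gamma(\emptyset)=0$. Let $\mathcal{S}_p=\{f:V\to\mathbb{R}:\|f\|_p=1\}$, $\mathcal{F}_k(\mathcal{S}_p)=\{A\subseteq\mathcal{S}_p: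 A=-A \text{ closed},\ \gamma(A)\ge k\}$, and $$\mathcal{R}_{\mathcal{H}_p}(f)=\frac{\sum_{uv\in E}\omega_{uv}|f(u)-f(v)|^p+\sum_{u\in V}\kappa_u|f(u)|^p}{\sum_{u\in V}\varrho_u|f(u)|^p}.$$ The variational eigenvalues are $\lambda_k=\min_{A\in\mathcal{F}_k(\mathcal{S}_p)}\max_{f\in A}\mathcal{R}_{\mathcal{H}_p}(f)$, $k=1,\dots,N$, so $\lambda_1\le\dots\le\lambda_N$. Not every eigenvalue is assumed variational. A nodal domain induced by $f$ is (the vertex set of) a maximal connected subgraph of $\mathcal{G}$ on which $f$ is nonzero and has constant sign. *)

(* Defs.v *)
From HB Require Import structures.
From mathcomp Require Import all_boot all_order all_algebra.
From mathcomp Require Import all_classical all_reals all_analysis.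

Set Implicit Arguments.
Unset Strict Implicit.
Unset Printing Implicit Defensive.

Import Order.TTheory GRing.Theory Num.Theory.
Import numFieldNormedType.Exports.

Local Open Scope classical_set_scope.
Local Open Scope ring_scope.

(* Throughout, a graph on the finite vertex type V is an adjacency relation
   e : rel V, and omega u v is only meaningful when e u v holds. *)

(* [0 `^ a] is 0 or 1 whatever the sign of a, so phi_p p 0 = 0 also when
   p <= 2. *)
Definition phi_p (R : realType) (p x : R) : R := `|x| `^ (p - 2) * x.

Definition p_laplacian (R : realType) (V : finType) (e : rel V)
    (omega : V -> V -> R) (kappa : V -> R) (p : R) (f : V -> R) (u : V) : R :=
  \sum_(v | e u v) omega u v * phi_p p (f u - f v) + kappa u * phi_p p (f u).

Definition p_eigenfunction (R : realType) (V : finType) (e : rel V)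
    (omega : V -> V -> R) (kappa rho : V -> R) (p lambda : R) (f : V -> R) :=
  f <> (fun=> 0) /\
  forall u, p_laplacian e omega kappa p f u = lambda * rho u * phi_p p (f u).

Definition p_eigenvalue (R : realType) (V : finType) (e : rel V)
    (omega : V -> V -> R) (kappa rho : V -> R) (p lambda : R) :=
  exists f, p_eigenfunction e omega kappa rho p lambda f.

(* The factor 1/2 is there because the double sum visits every undirected edge
   twice, as (u, v) and as (v, u). *)
Definition rayleigh (R : realType) (V : finType) (e : rel V)
    (omega : V -> V -> R) (kappa rho : V -> R) (p : R) (f : V -> R) : R :=
  (2^-1 * (\sum_u \sum_(v | e u v) omega u v * `|f u - f v| `^ p)
     + \sum_u kappa u * `|f u| `^ p)
  / (\sum_u rho u * `|f u| `^ p).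

(* For finite V, the pointwise topology of {ptws V -> R} is the usual topology
   of the Euclidean space of dimension #|V|. *)
Definition p_sphere (R : realType) (V : finType) (p : R) :
    set {ptws V -> R} :=
  [set f | (\sum_v `|f v| `^ p) `^ p^-1 = 1].

Definition symmetric_set (R : realType) (V : finType)
    (A : set {ptws V -> R}) := [set - f | f in A] = A.

Definition odd_nonvanishing_map (R : realType) (V : finType)
    (A : set {ptws V -> R}) (k : nat) :=
  exists phi : {ptws V -> R} -> 'rV[R]_k,
    [/\ {within A, continuous phi},
        forall f, A f -> phi (- f) = - phi f &
        forall f, A f -> phi f <> 0].

(* Krasnoselskii genus; None stands for infinity. *)
Definition genus (R : realType) (V : finType)
    (A : set {ptws V -> R}) : option nat :=
  match pselect (exists k, `[< odd_nonvanishing_map A k >]) with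
  | left exk => Some (ex_minn exk)
  | right _ => None
  end.

Definition genus_ge (R : realType) (V : finType)
    (A : set {ptws V -> R}) (k : nat) : bool :=
  if genus A is Some m then (k <= m)%N else true.

(* The convention for the empty set needs no separate clause. *)
Lemma genus0 (R : realType) (V : finType) :
  genus (set0 : set {ptws V -> R}) = Some 0%N.
Proof.
have H : odd_nonvanishing_map (set0 : set {ptws V -> R}) 0.
  exists (fun=> 0); split=> //.
  by move=> f; exact: cvg_cst.
rewrite /genus; case: pselect => [exk|]; last by case; exists 0%N; exact/asboolP.
congr Some; case: ex_minnP => m _ /(_ 0%N).
by rewrite leqn0 => /(_ (asboolT H)) /eqP.
Qed.

Definition genus_family (R : realType) (V : finType) (p : R) (k : nat) :
    set (set {ptws V -> R}) :=
  [set A | [/\ A `<=` p_sphere p, symmetric_set A, closed A & genus_ge A k]].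

Definition is_max (R : realType) (S : set R) (m : R) := S m /\ ubound S m.
Definition is_min (R : realType) (S : set R) (m : R) := S m /\ lbound S m.

(* "l = min_A max_{f in A} rayleigh f", both extrema being attained. *)
Definition is_variational_eigenvalue (R : realType) (V : finType) (e : rel V)
    (omega : V -> V -> R) (kappa rho : V -> R) (p : R) (k : nat) (l : R) :=
  is_min [set m | exists2 A : set {ptws V -> R}, genus_family p k A &
                  is_max [set rayleigh e omega kappa rho p f | f in A] m] l.

Definition connected_in (V : finType) (e : rel V) (D : {set V}) : bool :=
  (D != finset.set0) &&
  [forall x in D, forall y in D,
     connect [rel u v | [&& u \in D, v \in D & e u v]] x y].

Definition constant_sign (R : realType) (V : finType) (f : V -> R)
    (D : {set V}) : bool :=
  [forall x in D, 0 < f x] || [forall x in D, f x < 0].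

Definition nodal_domain (R : realType) (V : finType) (e : rel V)
    (f : V -> R) : pred {set V} :=
  fun D => maxset (fun B => connected_in e B && constant_sign f B) D.

(* Main.v *)
Require Import Defs.
From HB Require Import structures.
From mathcomp Require Import all_boot all_order all_algebra.
From mathcomp Require Import ring.
From mathcomp Require Import all_classical all_reals all_analysis.
Set Implicit Arguments.
Unset Strict Implicit.
Unset Printing Implicit Defensive.
Import Order.TTheory GRing.Theory Num.Theory.
Import numFieldNormedType.Exports.
Local Open Scope classical_set_scope.
Local Open Scope ring_scope.

(** Let f be an eigenfunction for lambda, and let X contain one vertex of each
nodal domain of f.  The functions u |-> c u * f u, with c constant on every
nodal domain, form a linear space W of dimension #|X|, because f restricted to
the distinct nodal domains gives linearly independent functions.  The theorem
compares W with the min-max formula for lam #|X|.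

On W the Rayleigh quotient is at most lambda ([rayleigh_scale_le]).  Test the
eigenvalue equation against u |-> |c u|^p * f u and sum by parts
([p_laplacian_green]).  The vertex terms are then those of the Rayleigh
quotient of c * f, so that only the edge terms remain to be compared, one edge
at a time ([edge_energy_le]): inside a nodal domain there is equality, by
homogeneity, and across an edge where f changes sign the inequality is the
convexity of |.|^p.  When c is constant everything is an equality, so the
bound lambda is attained on W, at multiples of f itself
([rayleigh_eigenfunction]); hence lambda is the maximum of the Rayleigh
quotient over the unit sphere of W, by an explicit maximizer rather than by
compactness.

The sphere of W has genus at least #|X| ([genus_ge_sphere_fixed]).  This is a
form of the Borsuk-Ulam theorem, obtained here by reduction to the full
sphere.  Let P be a projection onto W such that h - P h is determined by its
values on a set C of vertices.  An odd nonvanishing map phi from the sphere of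
W to R^m extends to the odd nonvanishing map
h |-> (|P h| phi (P h / |P h|) / |phi (P h / |P h|)|, (h - P h) on C),
from the full sphere to R^(m + #|C|).  So if m < #|V| - #|C|, then every
closed symmetric subset of the full sphere has genus less than #|V|.  But the
variational eigenvalue of index #|V| is a minimum over the closed symmetric
sets of genus at least #|V|, so such a set exists: the topological input is
contained in the existence of that eigenvalue.

Consequently lam #|X| <= lambda.  If f had k or more nodal domains, then
lam k <= lam #|X| <= lambda, against lambda < lam k. *)

(** * Nodal domains as connected components *)

(** Same-sign edges cut the graph exactly into the nodal domains, and isolate
the zeros of f. *)
Definition same_sign_edge (R : realType) (V : finType) (e : rel V)
    (f : V -> R) : rel V := fun u v => e u v && (0 < f u * f v).

Section NodalDomains.
Variables (R : realType) (V : finType) (e : rel V) (f : V -> R).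
Hypothesis e_sym : symmetric e.
Local Notation ef := (same_sign_edge e f).

Lemma same_sign_connect_sym : connect_sym ef.
Proof.
by apply: sym_connect_sym => u v; rewrite /same_sign_edge /= e_sym mulrC.
Qed.

(** The product of f over consecutive vertices is positive, so the sign cannot
change along a path. *)
Lemma connect_same_sign u v : f u != 0 -> connect ef u v -> 0 < f u * f v.
Proof.
move=> fu /connectP[s +] ->{v}.
elim: s u fu => [|w s IHs] u fu /=; first by rewrite -expr2 exprn_even_gt0.
move=> /andP[/andP[_ uw] ws].
have fw : f w != 0 by apply: contraTneq uw => ->; rewrite mulr0 ltxx.
have /= ww := IHs w fw ws.
have : 0 < (f u * f w) * (f w * f (last w s)) by exact: mulr_gt0.
rewrite mulrA -(mulrA (f u)) -expr2 mulrAC pmulr_lgt0 //.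
by rewrite exprn_even_gt0.
Qed.

(** [connected_in] asks for paths that stay in the component; a path of
same-sign edges that starts there never leaves it. *)
Lemma connected_in_component u :
  connected_in e [set v | connect ef u v]%SET.
Proof.
apply/andP; split.
  by apply/set0Pn; exists u; rewrite inE.
apply/forall_inP => x; rewrite inE => ux.
apply/forall_inP => y; rewrite inE => uy.
have /connectP[s] : connect ef x y.
  by rewrite (connect_trans _ uy) // same_sign_connect_sym.
move=> + -> {y uy}; elim: s x ux => [|w s IHs] x ux //= /andP[xw ws].
have uw : connect ef u w := connect_trans ux (connect1 xw).
apply: connect_trans (IHs _ uw ws); apply: connect1 => /=.
by rewrite !inE ux uw; case/andP: xw.
Qed.

Lemma constant_sign_component u : f u != 0 ->
  constant_sign f [set v | connect ef u v]%SET.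
Proof.
move=> fu; have [u0|u0|u0] := ltgtP (f u) 0; last by rewrite u0 eqxx in fu.
  apply/orP; right; apply/forall_inP => v.
  by rewrite inE => /(connect_same_sign fu); rewrite nmulr_rgt0.
apply/orP; left; apply/forall_inP => v; rewrite inE => /(connect_same_sign fu).
by rewrite pmulr_rgt0.
Qed.

(** A nodal domain lies in the component of each of its vertices, which is
itself connected and of constant sign; maximality makes them equal. *)
Lemma nodal_domain_component D : nodal_domain e f D ->
  exists2 u, f u != 0 & D = [set v | connect ef u v]%SET.
Proof.
move=> /maxsetP[/andP[/andP[/set0Pn[u uD] /forall_inP conD] sgnD] maxD].
have sgn v w : v \in D -> w \in D -> 0 < f v * f w.
  move=> vD wD; case/orP: sgnD => /forall_inP sD.
    by rewrite mulr_gt0 ?sD.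
  by rewrite nmulr_rgt0 ?sD.
have fu : f u != 0.
  by apply: contraTneq (sgn u u uD uD) => ->; rewrite mul0r ltxx.
exists u => //; apply/esym/maxD.
  by rewrite connected_in_component constant_sign_component.
apply/fintype.subsetP => v vD; rewrite inE.
have /forall_inP/(_ _ vD) := conD u uD.
apply: connect_sub => x y /= /and3P[xD yD xy]; apply: connect1.
by rewrite /same_sign_edge xy sgn.
Qed.

(** One representative of each nodal domain. *)
Definition nodal_roots : {set V} :=
  [set u | (fingraph.root ef u == u) && (f u != 0)]%SET.

Lemma root_nodal_roots u : f u != 0 -> fingraph.root ef u \in nodal_roots.
Proof.
move=> fu; have ur := connect_root ef u.
rewrite inE fingraph.root_root ?eqxx; last exact: same_sign_connect_sym.
by apply: contraTneq (connect_same_sign fu ur) => ->; rewrite mulr0 ltxx.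
Qed.

Lemma card_nodal_domain_le : (#|nodal_domain e f| <= #|nodal_roots|)%N.
Proof.
pose C u := [set v | connect ef u v]%SET.
apply: (@leq_trans #|(C @: nodal_roots)%SET|); last exact: leq_imset_card.
apply/subset_leq_card/fintype.subsetP => D /nodal_domain_component[u fu ->].
apply/imsetP; exists (fingraph.root ef u); first exact: root_nodal_roots.
apply/setP => v; rewrite !inE.
exact: (same_connect same_sign_connect_sym (connect_root ef u)).
Qed.

End NodalDomains.

(** * The edge inequality *)

Section EdgeInequality.
Variables (R : realType) (p : R).
Hypothesis p1 : 1 < p.
Let p0 : 0 < p. Proof. exact: lt_trans p1. Qed.

Lemma phi_pMx (x : R) : phi_p p x * x = `|x| `^ p.
Proof.
rewrite /phi_p; have [->|x0] := eqVneq x 0.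
  by rewrite mulr0 normr0 powR0 // gt_eqF.
rewrite -mulrA -expr2 -real_normK ?num_real // -powR_mulrn // -powRD ?subrK //.
by rewrite normr_eq0 x0 implybT.
Qed.

Lemma phi_pN (x : R) : phi_p p (- x) = - phi_p p x.
Proof. by rewrite /phi_p normrN mulrN. Qed.

Lemma phi_p_gt0 (x : R) : 0 < x -> phi_p p x = x `^ (p - 1).
Proof.
move=> x0; have := phi_pMx x.
rewrite gtr0_norm // -(mulr_powRB1 (ltW x0) p0) mulrC.
by move/mulfI; apply; rewrite gt_eqF.
Qed.

(** Jensen's inequality for |.|^p with the weights x / (x + y) and
y / (x + y), cleared of denominators. *)
Lemma powR_weighted_sum_le (a b x y : R) : 0 < x -> 0 < y ->
  `|a * x + b * y| `^ p <=
  (x + y) `^ (p - 1) * (`|a| `^ p * x + `|b| `^ p * y).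
Proof.
move=> x0 y0; have xy0 : 0 < x + y by exact: addr_gt0.
have [t [t0 t1 xE]] : exists t : R, [/\ 0 <= t, t <= 1 & x = (x + y) * t].
  exists (x / (x + y)); split; first by rewrite divr_ge0 // ltW.
    by rewrite ler_pdivrMr // mul1r lerDl ltW.
  by rewrite mulrC divfK // gt_eqF.
have cvx : (t * `|a| + (1 - t) * `|b|) `^ p <=
    t * `|a| `^ p + (1 - t) * `|b| `^ p.
  apply: (@convex_powR R p (ltW p1) (Itv01 t0 t1) `|a| `|b|);
    by rewrite inE /= in_itv /= andbT.
have yE : y = (x + y) * (1 - t) by rewrite mulrBr mulr1 -xE addrAC subrr add0r.
have -> : `|a| `^ p * x + `|b| `^ p * y =
    (x + y) * (t * `|a| `^ p + (1 - t) * `|b| `^ p).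
  by rewrite mulrDr !mulrA -xE -yE ![_ * `|_| `^ _]mulrC.
rewrite mulrA [_ * (x + y)]mulrC mulr_powRB1 //; last exact: ltW.
apply: (le_trans _ (ler_wpM2l (powR_ge0 _ _) cvx)).
rewrite -powRM; first last.
- by rewrite addr_ge0 ?mulr_ge0 ?subr_ge0.
- exact: ltW.
have sum_ge0 : 0 <= (x + y) * (t * `|a| + (1 - t) * `|b|).
  by rewrite mulr_ge0 ?(ltW xy0) // addr_ge0 ?mulr_ge0 ?subr_ge0.
apply: ge0_ler_powR; rewrite ?nnegrE ?(ltW p0) //.
rewrite mulrDr !mulrA -xE -yE (le_trans (ler_normD _ _)) // !normrM.
by rewrite (gtr0_norm x0) (gtr0_norm y0) ![_ * `|_|]mulrC.
Qed.

(** Here x and y are the values of f at the two ends of an edge, and a and b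
those of the factor c in c * f.  If x and y have the same sign then a = b and
both sides agree; likewise if one of them vanishes.  The case of opposite signs
is Jensen's inequality with the positive weights |x| and |y|. *)
Lemma edge_energy_le (a b x y : R) : (0 < x * y -> a = b) ->
  `|a * x - b * y| `^ p <=
  phi_p p (x - y) * (`|a| `^ p * x - `|b| `^ p * y).
Proof.
have [xy /(_ isT) ->|xy _] := ltP 0 (x * y).
  rewrite -mulrBr -mulrBr mulrCA phi_pMx normrM powRM //.
have zero z c : `|c * z| `^ p <= phi_p p z * (`|c| `^ p * z).
  by rewrite mulrCA phi_pMx normrM powRM.
have opp x' y' : 0 < x' -> y' < 0 ->
    `|a * x' - b * y'| `^ p <=
    phi_p p (x' - y') * (`|a| `^ p * x' - `|b| `^ p * y').
  move=> x0 y0; have xy0 : 0 < x' - y' by rewrite subr_gt0 (lt_trans y0).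
  rewrite phi_p_gt0 // -!mulrN; apply: powR_weighted_sum_le => //.
  by rewrite oppr_gt0.
have [x0|x0|x0] := ltgtP x 0;
  last by rewrite x0 !mulr0 !sub0r phi_pN normrN mulrNN.
- have [y0|y0|y0] := ltgtP y 0; last by rewrite y0 !mulr0 !subr0.
    by move: xy; rewrite leNgt nmulr_rgt0 // y0.
  (* Both sides are invariant under (x, y) |-> (-x, -y). *)
  have -> : a * x - b * y = - (a * (- x) - b * (- y)) by ring.
  have -> : x - y = - (- x - - y) by ring.
  have -> : `|a| `^ p * x - `|b| `^ p * y =
      - (`|a| `^ p * (- x) - `|b| `^ p * (- y)) by ring.
  by rewrite normrN phi_pN mulrNN opp; rewrite ?oppr_gt0 ?oppr_lt0.
- have [y0|y0|y0] := ltgtP y 0; last by rewrite y0 !mulr0 !subr0.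
    exact: opp.
  by move: xy; rewrite leNgt mulr_gt0.
Qed.

End EdgeInequality.

(** * Rayleigh quotients of rescaled eigenfunctions *)

Section Energy.
Variables (R : realType) (V : finType) (e : rel V).
Variables (omega : V -> V -> R) (kappa rho : V -> R) (p lambda : R).
Hypothesis e_sym : symmetric e.
Hypothesis omega_gt0 : forall u v, e u v -> 0 < omega u v.
Hypothesis omega_sym : forall u v, e u v -> omega u v = omega v u.
Hypothesis rho_gt0 : forall u, 0 < rho u.
Hypothesis p1 : 1 < p.

(** Summation by parts: every edge occurs as (u, v) and as (v, u), with
opposite values of phi_p, hence the difference g u - g v and the factor 1/2. *)
Lemma p_laplacian_green (f g : V -> R) :
  \sum_u p_laplacian e omega kappa p f u * g u =
  2^-1 * (\sum_u \sum_(v | e u v)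
            omega u v * (phi_p p (f u - f v) * (g u - g v)))
    + \sum_u kappa u * (phi_p p (f u) * g u).
Proof.
under eq_bigr => u _.
  rewrite /p_laplacian mulrDl mulr_suml -mulrA.
  over.
rewrite big_split /=; congr (_ + _).
set S := LHS.
have S_swap : S = \sum_u \sum_(v | e u v)
    - (omega u v * phi_p p (f u - f v) * g v).
  rewrite /S (exchange_big_dep xpredT) //=; apply: eq_bigr => u _.
  under eq_bigl => v do rewrite e_sym.
  apply: eq_bigr => v uv.
  by rewrite -opprB phi_pN mulrN mulNr -(omega_sym uv).
have -> : \sum_u \sum_(v | e u v)
    omega u v * (phi_p p (f u - f v) * (g u - g v)) = S + S.
  rewrite {2}S_swap -big_split /=; apply: eq_bigr => u _.
  by rewrite -big_split /=; apply: eq_bigr => v _; ring.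
by rewrite -mulr2n -[S *+ 2]mulr_natl mulrA mulVf ?pnatr_eq0 // mul1r.
Qed.

Lemma eigenfunction_weak (f g : V -> R) :
  p_eigenfunction e omega kappa rho p lambda f ->
  lambda * \sum_u rho u * (phi_p p (f u) * g u) =
  2^-1 * (\sum_u \sum_(v | e u v)
            omega u v * (phi_p p (f u - f v) * (g u - g v)))
    + \sum_u kappa u * (phi_p p (f u) * g u).
Proof.
case=> _ eigf; rewrite -p_laplacian_green mulr_sumr; apply: eq_bigr => u _.
by rewrite eigf; ring.
Qed.

Lemma p_mass_gt0 (h : V -> R) : h <> (fun=> 0) ->
  0 < \sum_u rho u * `|h u| `^ p.
Proof.
move=> h0; have [u hu] : exists u, h u != 0.
  apply: contrapT => /forallNP hN; apply: h0; apply/funext => u.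
  by apply/eqP; rewrite -[_ == _]negbK; apply/negP/hN.
rewrite (bigD1 u) //= ltr_pwDl //; last first.
  by apply: sumr_ge0 => v _; rewrite mulr_ge0 ?powR_ge0 // ltW.
by rewrite mulr_gt0 // powR_gt0 // normr_gt0.
Qed.

(** The test function u |-> |c u|^p * f u turns the vertex terms of the weak
equation into those of the Rayleigh quotient of c * f. *)
Lemma rayleigh_scale_le (f c : V -> R) :
  p_eigenfunction e omega kappa rho p lambda f ->
  (forall u v, e u v -> 0 < f u * f v -> c u = c v) ->
  (fun u => c u * f u) <> (fun=> 0) ->
  rayleigh e omega kappa rho p (fun u => c u * f u) <= lambda.
Proof.
move=> eigf c_const h0; rewrite /rayleigh ler_pdivrMr; last exact: p_mass_gt0.
have powE (w : V -> R) : \sum_u w u * `|c u * f u| `^ p =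
    \sum_u w u * (phi_p p (f u) * (`|c u| `^ p * f u)).
  apply: eq_bigr => u _; congr (_ * _).
  by rewrite [RHS]mulrCA phi_pMx // normrM powRM.
rewrite !powE (eigenfunction_weak _ eigf) lerD2r ler_wpM2l //.
apply: ler_sum => u _; apply: ler_sum => v uv.
apply: ler_wpM2l; first exact/ltW/omega_gt0.
by apply: edge_energy_le => // /(c_const _ _ uv).
Qed.

Lemma rayleigh_eigenfunction (f : V -> R) (c : R) : c != 0 ->
  p_eigenfunction e omega kappa rho p lambda f ->
  rayleigh e omega kappa rho p (fun u => c * f u) = lambda.
Proof.
move=> c0 eigf; have [f0 _] := eigf.
have h0 : (fun u => c * f u) <> (fun=> 0).
  move=> cf0; apply: f0; apply/funext => u.
  by have /= /eqP := congr1 (@^~ u) cf0; rewrite mulf_eq0 (negPf c0) => /eqP.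
rewrite /rayleigh; apply/(canLR (mulfK _)).
  by rewrite gt_eqF // p_mass_gt0.
have pow x : `|c * x| `^ p = phi_p p x * (`|c| `^ p * x).
  by rewrite [RHS]mulrCA phi_pMx // normrM powRM.
under [in RHS]eq_bigr do rewrite pow.
rewrite (eigenfunction_weak _ eigf); congr (_ * _ + _).
  apply: eq_bigr => u _; apply: eq_bigr => v _.
  by rewrite -!mulrBr pow.
by apply: eq_bigr => u _; rewrite pow.
Qed.

End Energy.

(** * Continuity in function spaces and the p-norm *)

Section Continuity.
Variables (R : realType) (V : finType).

Lemma continuous_normr_powR (r : R) :
  0 < r -> continuous (fun x : R => `|x| `^ r).
Proof.
move=> r0 x; have [->|x0] := eqVneq x 0.
  suff : `|x| `^ r @[x --> (0 : R)] --> (0 : R).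
    by rewrite /continuous_at normr0 powR0 ?gt_eqF.
  apply/cvgrPdist_lt => eps eps0.
  have d0 : 0 < eps `^ r^-1 by rewrite powR_gt0.
  have epsE : eps = (eps `^ r^-1) `^ r.
    by rewrite -powRrM mulVf ?gt_eqF // powRr1 // ltW.
  apply: (@filterS _ (nbhs (0 : R)) _ _ _ _ (@nbhs0_lt R R _ d0)) => y /= y_lt.
  rewrite sub0r normrN ger0_norm ?powR_ge0 // epsE.
  by apply: gt0_ltr_powR; rewrite ?nnegrE // ltW.
apply: (@continuous_comp _ _ _ (fun x : R => `|x|) (fun y : R => y `^ r)).
  exact: norm_continuous.
apply: differentiable_continuous; apply/derivable1_diffP.
by apply: derivable_powR; rewrite in_itv /= andbT normr_gt0.
Qed.

Lemma ptws_coord_continuous (v : V) : continuous (fun h : {ptws V -> R} => h v).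
Proof. exact: (@proj_continuous V (fun=> R) v). Qed.

Lemma ptws_continuous_at (T : topologicalType) (F : T -> {ptws V -> R})
    (x : T) :
  (forall v, {for x, continuous (fun y => F y v)}) -> {for x, continuous F}.
Proof.
move=> cF; apply/cvg_sup => v; apply/cvg_image.
  by rewrite eqEsubset; split => y // _; exists (fun=> y).
move=> W /= /cF; rewrite nbhs_simpl => nW.
exists ((fun h : {ptws V -> R} => h v) @^-1` W) => //.
by rewrite eqEsubset; split => [_ [g + <-]|y Wy] //; exists (fun=> y).
Qed.

Lemma mx_cvg (T : Type) (m n : nat) (F : set_system T)
    (G : T -> 'M[R]_(m, n)) (M : 'M[R]_(m, n)) : Filter F ->
  (forall i j, (fun x => G x i j) @ F --> M i j) -> G @ F --> M.
Proof.
move=> FF cG A [P M_P sPA].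
have FP : \forall x \near F, forall ij, P ij.1 ij.2 (G x ij.1 ij.2).
  by apply: filter_forall => -[i j]; apply: cG; exact: M_P.
apply: (@filterS _ F _ _ _ _ FP) => x Px.
by apply: sPA => i j; exact: (Px (i, j)).
Qed.

Lemma normr_coord_le m (M : 'rV[R]_m) j : `|M 0 j| <= `|M|.
Proof.
rewrite [in leRHS]/Num.norm /= mx_normrE.
exact: (@le_bigmax _ _ _ 0 (fun ij : 'I_1 * 'I_m => `|M ij.1 ij.2|) (0, j)).
Qed.

Lemma continuous_coord (P : {ptws V -> R} -> {ptws V -> R}) (v : V) :
  continuous P -> continuous (fun h => P h v).
Proof.
move=> P_cont h.
apply: (@continuous_comp _ _ _ P (fun g : {ptws V -> R} => g v)).
  exact: P_cont.
exact: ptws_coord_continuous.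
Qed.

End Continuity.

Section LpNorm.
Variables (R : realType) (V : finType) (p : R).
Hypothesis p0 : 0 < p.

Definition lp_norm (h : V -> R) : R := (\sum_v `|h v| `^ p) `^ p^-1.

Lemma lp_norm_ge0 h : 0 <= lp_norm h.
Proof. exact: powR_ge0. Qed.

Lemma lp_normZ (c : R) h : lp_norm (fun v => c * h v) = `|c| * lp_norm h.
Proof.
rewrite /lp_norm; under eq_bigr do rewrite normrM powRM //.
rewrite -mulr_sumr powRM ?powR_ge0 //; last first.
  by apply: sumr_ge0 => v _; rewrite powR_ge0.
by rewrite -powRrM mulfV ?gt_eqF // powRr1.
Qed.

Lemma lp_norm_eq0 h : lp_norm h = 0 -> h = (fun=> 0).
Proof.
move=> /powR_eq0_eq0/eqP; rewrite psumr_eq0 => [|v _]; last exact: powR_ge0.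
move=> /allP h0; apply/funext => v; have := h0 v (mem_index_enum v).
by rewrite /= powR_eq0 normr_eq0 => /andP[/eqP].
Qed.

Lemma lp_norm0 : lp_norm (fun=> 0) = 0.
Proof.
rewrite /lp_norm big1 ?powR0 ?invr_eq0 ?gt_eqF // => v _.
by rewrite normr0 powR0 // gt_eqF.
Qed.

Lemma lp_norm_continuous : continuous (lp_norm : {ptws V -> R} -> R).
Proof.
have -> : lp_norm = (fun h => `|\sum_v `|h v| `^ p| `^ p^-1).
  apply/funext => h /=; rewrite ger0_norm //.
  by apply: sumr_ge0 => v _; rewrite powR_ge0.
have c_sum : continuous (fun h : {ptws V -> R} => \sum_v `|h v| `^ p).
  have c_op : continuous (fun x : R * R => x.1 + x.2) by exact: add_continuous.
  apply: (@continuous_big R V _ 0 xpredT c_op {ptws V -> R} (index_enum V)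
    (fun v (g : {ptws V -> R}) => `|g v| `^ p)) => v _ g.
  apply: (@continuous_comp _ _ _ (fun h : {ptws V -> R} => h v)
    (fun x : R => `|x| `^ p)).
    exact: ptws_coord_continuous.
  exact: continuous_normr_powR.
move=> h.
apply: (@continuous_comp _ _ _ (fun h : {ptws V -> R} => \sum_v `|h v| `^ p)
  (fun x : R => `|x| `^ p^-1)); first exact: c_sum.
by apply: continuous_normr_powR; rewrite invr_gt0.
Qed.

End LpNorm.

(** * Genus of the sphere of a subspace *)

Section Genus.
Variables (R : realType) (V : finType).

Lemma genus_geP (A : set {ptws V -> R}) k :
  genus_ge A k <-> forall m, (m < k)%N -> ~ odd_nonvanishing_map A m.
Proof.
rewrite /genus_ge /genus; case: pselect => [exk|nexk].
  case: ex_minnP => n /asboolP An n_min; split => [kn m mk Am|noA].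
    by have := n_min m (asboolT Am); rewrite leqNgt (leq_trans mk).
  by rewrite leqNgt; apply/negP => /noA.
by split => // _ m _ Am; apply: nexk; exists m; exact/asboolP.
Qed.

Variable p : R.
Hypothesis p0 : 0 < p.

Lemma ptws_oppE (g : {ptws V -> R}) : - g = (fun v => -1 * g v).
Proof. by apply/funext => v; rewrite mulN1r. Qed.

Lemma homogeneousN (P : {ptws V -> R} -> {ptws V -> R}) :
  (forall t h, P (fun v => t * h v) = (fun v => t * P h v)) ->
  forall h, P (- h) = - P h.
Proof. by move=> PZ h; rewrite !ptws_oppE PZ. Qed.

(** In this section P plays the role of a projection onto a subspace W, and phi
is an odd nonvanishing map on the unit sphere of W. *)
Section RadialExtension.
Variables (P : {ptws V -> R} -> {ptws V -> R}) (m : nat)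
  (phi : {ptws V -> R} -> 'rV[R]_m).
Let A := p_sphere p `&` [set h | P h = h].
Hypothesis P_cont : continuous P.
Hypothesis PZ : forall t h, P (fun v => t * h v) = (fun v => t * P h v).
Hypothesis PK : forall h, P (P h) = P h.
Hypothesis phi_cont : {within A, continuous phi}.
Hypothesis phi_odd : forall f, A f -> phi (- f) = - phi f.
Hypothesis phi_neq0 : forall f, A f -> phi f <> 0.

Let n (h : {ptws V -> R}) : R := lp_norm p (P h).
Let dir (h : {ptws V -> R}) : {ptws V -> R} := fun v => (n h)^-1 * P h v.

(** phi need not have a limit along [dir] where P h = 0, but phi / |phi| is
bounded, so that the factor |P h| makes the map continuous there too. *)
Definition radial_extension (h : {ptws V -> R}) : 'rV[R]_m :=
  (n h / `|phi (dir h)|) *: phi (dir h).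

Let PN h : P (- h) = - P h := homogeneousN PZ h.

Let n_cont : continuous n.
Proof.
move=> h; apply: (@continuous_comp _ _ _ P (lp_norm p : {ptws V -> R} -> R)).
  exact: P_cont.
exact: lp_norm_continuous.
Qed.

Let dir_in h : n h != 0 -> A (dir h).
Proof.
move=> nh0; split; last by rewrite /= /dir PZ PK.
change (lp_norm p (dir h) = 1).
by rewrite lp_normZ // ger0_norm ?invr_ge0 ?lp_norm_ge0 // mulVf.
Qed.

Let nN h : n (- h) = n h.
Proof.
by rewrite /n PN ptws_oppE lp_normZ // normrN1 mul1r.
Qed.

Lemma radial_extensionN h : radial_extension (- h) = - radial_extension h.
Proof.
have [nh0|nh0] := eqVneq (n h) 0.
  by rewrite /radial_extension nN nh0 !mul0r !scale0r oppr0.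
have dirN : dir (- h) = - dir h.
  by apply/funext => v; rewrite /dir nN PN /= mulrN.
rewrite /radial_extension nN dirN phi_odd; last exact: dir_in.
by rewrite normrN scalerN.
Qed.

Lemma radial_extension_neq0 h : A h -> radial_extension h <> 0.
Proof.
move=> Ah; have [h1 /= Phh] := Ah.
have nh1 : n h = 1 by rewrite /n Phh.
have dirE : dir h = h by apply/funext => v; rewrite /dir nh1 Phh invr1 mul1r.
have phih0 : phi h != 0 by exact/eqP/phi_neq0.
move/eqP; rewrite /radial_extension nh1 dirE scaler_eq0 (negPf phih0) orbF.
by rewrite mul1r invr_eq0 normr_eq0 (negPf phih0).
Qed.

Let dir_cont h : n h != 0 -> {for h, continuous dir}.
Proof.
move=> nh0; apply: ptws_continuous_at => v.
have c_inv : (n g)^-1 @[g --> h] --> (n h)^-1.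
  exact: (cvgV nh0 (@n_cont h)).
have c_P : P g v @[g --> h] --> P h v.
  exact: continuous_coord.
exact: (cvgM c_inv c_P).
Qed.

Let phi_dir_cont h : n h != 0 -> {for h, continuous (phi \o dir)}.
Proof.
move=> nh0; have /subspace_continuousP/(_ _ (dir_in nh0)) := phi_cont.
apply: cvg_comp => W; rewrite nbhs_simpl /= => AW.
(* phi is continuous only within A, where [dir] takes its values near h. *)
have near_n : \forall g \near h, n g != 0.
  exact: (cvgr_neq0 _ (@n_cont h) nh0).
have := dir_cont nh0 AW; apply: filterS2 near_n => g ng0; apply.
exact: dir_in.
Qed.

Lemma radial_extension_continuous : continuous radial_extension.
Proof.
move=> h; apply: (@mx_cvg _ _ _ _ (nbhs h) radial_extension) => i j.
rewrite (ord1 i).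
have -> : (fun g => radial_extension g 0 j) =
    (fun g => n g / `|phi (dir g)| * phi (dir g) 0 j).
  by apply/funext => g; rewrite mxE.
rewrite mxE; have [nh0|nh0] := eqVneq (n h) 0.
  (* Where P h = 0 the map is squeezed to 0 by |P g| itself. *)
  rewrite nh0 !mul0r; apply/norm_cvg0P.
  apply: (@squeeze_cvgr _ _ _ _ (cst 0) n).
  - apply: nearW => g; rewrite normr_ge0 /=.
    rewrite !normrM normfV normr_id (ger0_norm (lp_norm_ge0 _ _)) -mulrA.
    rewrite ler_piMr ?lp_norm_ge0 //.
    have [->|phi0] := eqVneq (phi (dir g)) 0.
      by rewrite normr0 invr0 mul0r.
    by rewrite mulrC ler_pdivrMr ?normr_gt0 // mul1r normr_coord_le.
  - exact: cvg_cst.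
  - by rewrite -nh0; exact: n_cont.
have c_phi := phi_dir_cont nh0.
have c_norm : `|phi (dir g)|^-1 @[g --> h] --> `|phi (dir h)|^-1.
  have phi0 : `|phi (dir h)| != 0.
    by rewrite normr_eq0; apply/eqP/phi_neq0/dir_in.
  exact: (cvgV phi0 (cvg_norm c_phi)).
have c_coord : phi (dir g) 0 j @[g --> h] --> phi (dir h) 0 j.
  apply: (@continuous_comp _ _ _ (phi \o dir) (fun M : 'rV[R]_m => M 0 j)).
    exact: c_phi.
  exact: coord_continuous.
exact: (cvgM (cvgM (@n_cont h) c_norm) c_coord).
Qed.

End RadialExtension.

(** A0 stands for the topological input: some symmetric subset of the full
sphere with at least the genus of a sphere of dimension #|V| - 1.  The condition
on C says that h - P h is determined by its values on C, so that the fixed space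
of P has dimension at least #|V| - #|C|. *)
Lemma genus_ge_sphere_fixed (A0 : set {ptws V -> R})
    (P : {ptws V -> R} -> {ptws V -> R}) (C : {set V}) :
  genus_family p #|V| A0 ->
  continuous P ->
  (forall t h, P (fun v => t * h v) = (fun v => t * P h v)) ->
  (forall h, P (P h) = P h) ->
  (forall h, {in C, forall v, P h v = h v} -> P h = h) ->
  genus_ge (p_sphere p `&` [set h | P h = h]) (#|V| - #|C|).
Proof.
move=> [A0S _ _ /genus_geP A0_genus] P_cont PZ PK PC; apply/genus_geP => m m_lt.
move=> [phi [phi_cont phi_odd phi_neq0]].
apply: (A0_genus (m + #|C|)%N); first by rewrite addnC -ltn_subRL.
pose rest (h : {ptws V -> R}) : 'rV[R]_#|C| :=
  \row_j (h (enum_val j) - P h (enum_val j)).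
pose ext (h : {ptws V -> R}) : 'rV[R]_(m + #|C|) :=
  row_mx (radial_extension P phi h) (rest h).
have ext_cont : continuous ext.
  move=> h; apply: (@mx_cvg _ _ _ _ (nbhs h) ext) => i j; rewrite (ord1 i).
  rewrite -[j]splitK; case: (fintype.split j) => k /=.
    have extE : (fun g => ext g 0 (lshift #|C| k)) =
        (fun g => radial_extension P phi g 0 k).
      by apply/funext => g; rewrite /ext row_mxEl.
    rewrite extE /ext row_mxEl.
    apply: (@continuous_comp _ _ _ (radial_extension P phi)
      (fun M : 'rV[R]_m => M 0 k)); last exact: coord_continuous.
    exact: radial_extension_continuous.
  have extE : (fun g => ext g 0 (rshift m k)) =
      (fun g => g (enum_val k) - P g (enum_val k)).
    by apply/funext => g; rewrite /ext row_mxEr mxE.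
  rewrite extE /ext row_mxEr mxE.
  have c_h : g (enum_val k) @[g --> h] --> h (enum_val k).
    exact: ptws_coord_continuous.
  have c_P : P g (enum_val k) @[g --> h] --> P h (enum_val k).
    exact: continuous_coord.
  exact: (@cvgB R R _ (nbhs h) _ _ _ _ _ c_h c_P).
exists ext; split.
- exact: (@continuous_subspaceT _ _ A0 ext ext_cont).
- move=> h _; rewrite /ext opp_row_mx radial_extensionN //; congr row_mx.
  apply/rowP => j; rewrite !mxE.
  by rewrite homogeneousN // !opprD.
- (* If the second block vanishes then P h = h, so h lies on the sphere of W,
     where the first block does not vanish. *)
  move=> h /A0S hS; rewrite /ext -[RHS]row_mx0 => /eq_row_mx[ext0 rest0].
  apply: (radial_extension_neq0 phi_neq0 _ ext0); split => //=.
  apply: PC => v vC; have /rowP/(_ (enum_rank_in vC v)) := rest0.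
  by rewrite !mxE enum_rankK_in // => /eqP; rewrite subr_eq0 => /eqP.
Qed.

Lemma fixed_sphere_closed (P : {ptws V -> R} -> {ptws V -> R}) :
  continuous P -> closed (p_sphere p `&` [set h | P h = h]).
Proof.
move=> P_cont; apply: closedI.
  apply: (@closed_comp _ _ (lp_norm p : {ptws V -> R} -> R) [set 1]).
    by move=> h _; exact: lp_norm_continuous.
  exact: closed_eq.
have -> : [set h | P h = h] =
    \bigcap_v [set h : {ptws V -> R} | P h v - h v = 0].
  apply/seteqP; split => [h /= Phh v _|h Ph]; first by rewrite /= Phh subrr.
  by apply/funext => v; apply/eqP; rewrite -subr_eq0; apply/eqP/Ph.
apply: closed_bigI => v _.
apply: (@closed_comp _ _ (fun h : {ptws V -> R} => P h v - h v) [set 0]).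
  move=> h _.
  have c_P : P g v @[g --> h] --> P h v.
    exact: continuous_coord.
  have c_h : g v @[g --> h] --> h v by exact: ptws_coord_continuous.
  exact: (@cvgB R R _ (nbhs h) _ _ _ _ _ c_P c_h).
exact: closed_eq.
Qed.

Lemma fixed_sphere_symmetric (P : {ptws V -> R} -> {ptws V -> R}) :
  (forall t h, P (fun v => t * h v) = (fun v => t * P h v)) ->
  symmetric_set (p_sphere p `&` [set h | P h = h]).
Proof.
move=> PZ; have oppS h : (p_sphere p `&` [set h | P h = h]) h ->
    (p_sphere p `&` [set h | P h = h]) (- h).
  move=> [hS /= Phh]; split; last by rewrite /= homogeneousN // Phh.
  rewrite ptws_oppE; change (lp_norm p (fun v => -1 * h v) = 1).
  by rewrite lp_normZ // normrN1 mul1r.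
apply/seteqP; split => [_ [h hS <-]|h hS]; first exact: oppS.
by exists (- h); rewrite ?opprK //; exact: oppS.
Qed.

End Genus.

(** * The space spanned by the nodal domains *)

Section NodalProjection.
Variables (R : realType) (V : finType) (e : rel V) (f : V -> R).
Hypothesis e_sym : symmetric e.
Local Notation ef := (same_sign_edge e f).
Local Notation rt := (fingraph.root ef).

(** The projection onto W that keeps the values of h at the representatives of
the nodal domains; its value at the zeros of f is 0. *)
Definition nodal_projection (h : {ptws V -> R}) : {ptws V -> R} :=
  fun u => h (rt u) / f (rt u) * f u.

Lemma nodal_projection_continuous : continuous nodal_projection.
Proof.
move=> h; apply: ptws_continuous_at => u.
have c_h : g (rt u) @[g --> h] --> h (rt u) by exact: ptws_coord_continuous.
have c_hf : g (rt u) / f (rt u) @[g --> h] --> h (rt u) / f (rt u).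
  by apply: (@cvgM R {ptws V -> R} (nbhs h) _ _ (fun=> _)) c_h _;
    exact: cvg_cst.
by apply: (@cvgM R {ptws V -> R} (nbhs h) _ _ (fun=> _)) c_hf _;
  exact: cvg_cst.
Qed.

Lemma nodal_projectionZ t h :
  nodal_projection (fun v => t * h v) = (fun v => t * nodal_projection h v).
Proof. by apply/funext => v; rewrite /nodal_projection !mulrA. Qed.

Lemma nodal_projectionK h :
  nodal_projection (nodal_projection h) = nodal_projection h.
Proof.
apply/funext => u; rewrite /nodal_projection.
rewrite fingraph.root_root; last exact: same_sign_connect_sym.
have [->|fu] := eqVneq (f (rt u)) 0; first by rewrite invr0 !(mulr0, mul0r).
by rewrite divfK.
Qed.

Lemma nodal_projection_fixed h :
  {in ~: nodal_roots e f, forall v, nodal_projection h v = h v} ->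
  nodal_projection h = h.
Proof.
move=> Ph; apply/funext => v; have [|vX] := boolP (v \in nodal_roots e f).
  rewrite inE => /andP[/eqP rv fv]; rewrite /nodal_projection rv divfK //.
by apply: Ph; rewrite inE.
Qed.

Lemma same_root u v : e u v -> 0 < f u * f v -> rt u = rt v.
Proof.
move=> uv fuv; apply/eqP.
rewrite fingraph.root_connect; last exact: same_sign_connect_sym.
by apply: connect1; rewrite /same_sign_edge uv.
Qed.

Lemma nodal_projection_scaled (c : R) :
  nodal_projection (fun v => c * f v) = (fun v => c * f v).
Proof.
apply/funext => u; rewrite /nodal_projection.
have [->|fu] := eqVneq (f u) 0; first by rewrite !mulr0.
by have := root_nodal_roots e_sym fu; rewrite inE => /andP[_ fr]; rewrite mulfK.
Qed.

End NodalProjection.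

Theorem theorem3p9 (R : realType) (V : finType) (e : rel V)
    (rho : V -> R) (omega : V -> V -> R) (kappa : V -> R) (p : R)
    (lam : nat -> R) (lambda : R) (k : nat) :
  symmetric e -> irreflexive e ->
  (forall u, 0 < rho u) ->
  (forall u v, e u v -> 0 < omega u v) ->
  (forall u v, e u v -> omega u v = omega v u) ->
  1 < p ->
  (forall u v, connect e u v) ->
  (forall j, (1 <= j <= #|V|)%N ->
     is_variational_eigenvalue e omega kappa rho p j (lam j)) ->
  ((2 <= #|V|)%N -> lam 1%N < lam 2%N) ->
  (forall i j, (2 <= i)%N -> (i <= j)%N -> (j <= #|V|)%N -> lam i <= lam j) ->
  (1 <= k <= #|V|)%N ->
  p_eigenvalue e omega kappa rho p lambda ->
  lambda < lam k ->
  forall f : V -> R, p_eigenfunction e omega kappa rho p lambda f ->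
  (#|nodal_domain e f| <= k.-1)%N.
Proof.
move=> e_sym _ rho_gt0 omega_gt0 omega_sym p1 _ lam_var lam12 lam_mono.
move=> /andP[k_gt0 k_le] _ lambda_lt f eigf.
have p0 : 0 < p := lt_trans ltr01 p1.
rewrite leqNgt prednK //; apply/negP => k_lt.
set M := #|nodal_roots e f|.
have kM : (k <= M)%N := leq_trans k_lt (card_nodal_domain_le f e_sym).
have MV : (M <= #|V|)%N by exact: max_card.
have lam_kM : lam k <= lam M.
  move: kM; rewrite leq_eqVlt => /predU1P[-> //|kM].
  have [k2|k2] := leqP 2 k; first by apply: lam_mono => //; exact: ltnW.
  have k1 : k = 1%N by apply/eqP; rewrite eqn_leq k_gt0 -ltnS k2.
  rewrite k1; rewrite k1 in kM.
  have V2 := leq_trans kM MV.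
  by rewrite (le_trans (ltW (lam12 V2))) // lam_mono.
suff lamM : lam M <= lambda.
  by have := lt_le_trans lambda_lt (le_trans lam_kM lamM); rewrite ltxx.
have M_gt0 : (0 < M)%N := leq_trans k_gt0 kM.
have [_ lamM_min] : is_variational_eigenvalue e omega kappa rho p M (lam M).
  by apply: lam_var; rewrite M_gt0.
(* The set attaining lam #|V| has genus #|V| or more. *)
have [[A0 A0_fam _] _] :
    is_variational_eigenvalue e omega kappa rho p #|V| (lam #|V|).
  by apply: lam_var; rewrite (leq_trans M_gt0 MV) /=.
pose P := @nodal_projection R V e f.
pose A := p_sphere p `&` [set h : {ptws V -> R} | P h = h].
(* The maximum over the sphere A of W is lambda, which bounds lam M. *)
apply: lamM_min; exists A.
  split; first by move=> h [].
  - exact: (fixed_sphere_symmetric p0 (@nodal_projectionZ R V e f)).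
  - exact: (fixed_sphere_closed p0 (@nodal_projection_continuous R V e f)).
  rewrite /M cardsCs; apply: (genus_ge_sphere_fixed p0 A0_fam).
  - exact: nodal_projection_continuous.
  - exact: nodal_projectionZ.
  - exact: nodal_projectionK.
  - exact: nodal_projection_fixed.
have [f0 _] := eigf.
have norm_gt0 : 0 < lp_norm p f.
  by rewrite lt0r lp_norm_ge0 andbT; apply/eqP => /lp_norm_eq0.
split.
  exists (fun v => (lp_norm p f)^-1 * f v); last first.
    by apply: rayleigh_eigenfunction => //; rewrite invr_eq0 gt_eqF.
  split; last exact: nodal_projection_scaled.
  change (lp_norm p (fun v => (lp_norm p f)^-1 * f v) = 1).
  by rewrite lp_normZ // ger0_norm ?invr_ge0 ?ltW // mulVf ?gt_eqF.
move=> _ [h [hS /= Ph] <-]; rewrite -Ph.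
apply: rayleigh_scale_le => //.
  by move=> u v uv fuv; rewrite (same_root e_sym uv fuv).
move=> Ph0; have h0 : h = (fun=> 0) by rewrite -Ph.
have : lp_norm p h = 1 by exact: hS.
by rewrite h0 lp_norm0 // => /esym/eqP; rewrite oner_eq0.
Qed.
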